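(* Let $R$ be an associative ring with identity and let $M$ be a left $R$-module. Then $\mathfrak{F}^{-1}(M)=\underline{\mathfrak{Pr}}^{-1}(M)$ if and only if every flat left $R$-module belongs to $\underline{\mathfrak{Pr}}^{-1}(M)$.
   Context: Modules are unital left $R$-modules. A flat precover of a module $N$ is a morphism $g:F\to N$ with $F$ flat such that $\mathrm{Hom}(F',F)\to\mathrm{Hom}(F',N)$ is surjective for every flat module $F'$. The flat-precover completing domain $\mathfrak{F}^{-1}(M)$ is the class of all modules $N$ such that for every morphism $f:M\to N$ and every flat precover $g:F\to N$ there is a morphism $h:M\to F$ with $gh=f$. The subprojectivity domain $\underline{\mathfrak{Pr}}^{-1}(M)$ is the class of all modules $N$ such that for every epimorphism $g:B\to N$ and every morphism $f:M\to N$ there is a morphism $h:M\to B$ with $gh=f$. *)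

(* Defs.v *)
From HB Require Import structures.
From mathcomp Require Import all_boot all_order all_algebra.
From mathcomp Require Import boolp.

Set Implicit Arguments.
Unset Strict Implicit.
Unset Printing Implicit Defensive.

Import GRing.Theory.
Local Open Scope ring_scope.
Local Open Scope quotient_scope.

(* Right R-modules are left modules over the converse ring R^c: for           *)
(* [A : lmodType R^c], the right action a.r is [(r : R^c) *: a].              *)

Section Tensor.
Variables (R : pzRingType) (A : lmodType R^c) (F : lmodType R).

(* The tensor product of A and F over R is presented as the quotient of the   *)
(* free monoid on A * F: the word [:: (a1, f1); ...; (an, fn)] stands for     *)
(* a1 (x) f1 + ... + an (x) fn.  No formal negatives are needed, because      *)
(* (-a) (x) f is an opposite of a (x) f once 0 (x) f = 0; lemma               *)
(* [tensor_universal] below is the usual universal property.                  *)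
Inductive tensor_eqv : seq (A * F) -> seq (A * F) -> Prop :=
| TensorRefl s : tensor_eqv s s
| TensorSym s t : tensor_eqv s t -> tensor_eqv t s
| TensorTrans t s u : tensor_eqv s t -> tensor_eqv t u -> tensor_eqv s u
| TensorCat s s' t t' :
    tensor_eqv s s' -> tensor_eqv t t' -> tensor_eqv (s ++ t) (s' ++ t')
| TensorComm s t : tensor_eqv (s ++ t) (t ++ s)
| TensorZero f : tensor_eqv [:: (0, f)] [::]
| TensorAddl a a' f : tensor_eqv [:: (a + a', f)] [:: (a, f); (a', f)]
| TensorAddr a f f' : tensor_eqv [:: (a, f + f')] [:: (a, f); (a, f')]
| TensorBalanced a (r : R) f :
    tensor_eqv [:: ((r : R^c) *: a, f)] [:: (a, r *: f)].

Definition tensor_rel : rel (seq (A * F)) := fun s t => `[< tensor_eqv s t >].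

Lemma tensor_rel_refl : reflexive tensor_rel.
Proof. by move=> s; apply/asboolP; exact: TensorRefl. Qed.

Lemma tensor_rel_sym : symmetric tensor_rel.
Proof. by move=> s t; apply/asboolP/asboolP; exact: TensorSym. Qed.

Lemma tensor_rel_trans : transitive tensor_rel.
Proof.
by move=> t s u /asboolP st /asboolP tu; apply/asboolP; exact: TensorTrans tu.
Qed.

Canonical tensor_equiv_rel :=
  EquivRel tensor_rel tensor_rel_refl tensor_rel_sym tensor_rel_trans.

Definition tensor : Type := {eq_quot tensor_equiv_rel}.

HB.instance Definition _ := Choice.on tensor.
HB.instance Definition _ := EqQuotient.on tensor.

Lemma tensor_piP s t :
  reflect (\pi_tensor s = \pi_tensor t) `[< tensor_eqv s t >].
Proof. exact: (iffP (@eqquotP _ tensor_rel tensor s t)). Qed.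

Definition tensor_add (x y : tensor) : tensor := \pi_tensor (repr x ++ repr y).
Definition tensor_opp (x : tensor) : tensor :=
  \pi_tensor [seq (- p.1, p.2) | p <- repr x].

Lemma tensor_repr_pi s : tensor_eqv (repr (\pi_tensor s)) s.
Proof. by apply/asboolP/tensor_piP; rewrite reprK. Qed.

Lemma tensor_pi_add s t :
  tensor_add (\pi_tensor s) (\pi_tensor t) = \pi_tensor (s ++ t).
Proof.
by apply/tensor_piP/asboolP; apply: TensorCat; exact: tensor_repr_pi.
Qed.

Lemma tensor_addA : associative tensor_add.
Proof.
elim/quotW=> s; elim/quotW=> t; elim/quotW=> u.
rewrite (tensor_pi_add t u) (tensor_pi_add s t) (tensor_pi_add s (t ++ u)).
by rewrite (tensor_pi_add (s ++ t) u) catA.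
Qed.

Lemma tensor_addC : commutative tensor_add.
Proof.
move=> x y; rewrite -[x]reprK -[y]reprK !tensor_pi_add.
by apply/tensor_piP/asboolP; exact: TensorComm.
Qed.

Lemma tensor_add0 : left_id (\pi_tensor [::]) tensor_add.
Proof. by move=> x; rewrite -[x]reprK tensor_pi_add. Qed.

Lemma tensor_addN : left_inverse (\pi_tensor [::]) tensor_opp tensor_add.
Proof.
move=> x; rewrite -{2}[x]reprK /tensor_opp tensor_pi_add.
apply/tensor_piP/asboolP.
elim: (repr x) => [|[a f] s IH] /=; first exact: TensorRefl.
set s' := map _ s.
apply: (@TensorTrans ([:: (- a, f); (a, f)] ++ (s' ++ s))).
  rewrite -(cat1s _ (s' ++ _)) -(cat1s _ s).
  rewrite [[:: (- a, f); _]](_ : _ = [:: (- a, f)] ++ [:: (a, f)]) //.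
  rewrite -catA; apply: TensorCat; first exact: TensorRefl.
  rewrite !catA; apply: TensorCat; last exact: TensorRefl.
  exact: TensorComm.
rewrite -[[::]]cat0s; apply: TensorCat => //.
apply: (@TensorTrans [:: (- a + a, f)]).
  exact/TensorSym/TensorAddl.
by rewrite addNr; exact: TensorZero.
Qed.

HB.instance Definition _ := GRing.isZmodule.Build tensor
  tensor_addA tensor_addC tensor_add0 tensor_addN.

Definition tens (a : A) (f : F) : tensor := \pi_tensor [:: (a, f)].

Record balanced (G : zmodType) (b : A -> F -> G) : Prop := Balanced {
  balancedDl : forall a a' f, b (a + a') f = b a f + b a' f;
  balancedDr : forall a f f', b a (f + f') = b a f + b a f';
  balancedZ : forall a (r : R) f, b ((r : R^c) *: a) f = b a (r *: f) }.

Lemma tens_balanced : balanced tens.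
Proof.
split=> [a a' f|a f f'|a r f].
- by rewrite [RHS]tensor_pi_add; apply/tensor_piP/asboolP; exact: TensorAddl.
- by rewrite [RHS]tensor_pi_add; apply/tensor_piP/asboolP; exact: TensorAddr.
- by apply/tensor_piP/asboolP; exact: TensorBalanced.
Qed.

Definition tensor_lift (G : zmodType) (b : A -> F -> G) (x : tensor) : G :=
  \sum_(p <- repr x) b p.1 p.2.

Lemma tensor_lift_pi (G : zmodType) (b : A -> F -> G) s : balanced b ->
  tensor_lift b (\pi_tensor s) = \sum_(p <- s) b p.1 p.2.
Proof.
move=> [bDl bDr bZ]; rewrite /tensor_lift; have := tensor_repr_pi s.
move: (repr _) => t; elim=> {s t} //=.
- by move=> s t u _ -> _ ->.
- by move=> s s' t t' _ es _ et; rewrite !big_cat /= es et.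
- by move=> s t; rewrite !big_cat /= addrC.
- move=> f; rewrite big_seq1 big_nil /=.
  by apply: (addrI (b 0 f)); rewrite -bDl !addr0.
- by move=> a a' f; rewrite !big_cons !big_nil /= bDl !addr0.
- by move=> a f f'; rewrite !big_cons !big_nil /= bDr !addr0.
- by move=> a r f; rewrite !big_seq1 /= bZ.
Qed.

Lemma pi_tensor_sum s : \pi_tensor s = \sum_(p <- s) tens p.1 p.2.
Proof.
elim: s => [|[a f] s IH]; first by rewrite big_nil.
by rewrite big_cons -IH [RHS]tensor_pi_add.
Qed.

Lemma tensor_liftD (G : zmodType) (b : A -> F -> G) : balanced b ->
  {morph tensor_lift b : x y / x + y}.
Proof.
move=> bb x y; rewrite -[x]reprK -[y]reprK [_ + _]tensor_pi_add.
by rewrite !tensor_lift_pi // big_cat.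
Qed.

Lemma tensor_lift_tens (G : zmodType) (b : A -> F -> G) a f : balanced b ->
  tensor_lift b (tens a f) = b a f.
Proof. by move=> bb; rewrite tensor_lift_pi // big_seq1. Qed.

Lemma tensor_universal (G : zmodType) (b : A -> F -> G) : balanced b ->
  exists! phi : tensor -> G,
    {morph phi : x y / x + y} /\ forall a f, phi (tens a f) = b a f.
Proof.
move=> bb; exists (tensor_lift b); split.
  split=> [|a f]; first exact: tensor_liftD.
  exact: tensor_lift_tens.
move=> phi [phiD phiE]; apply: funext => x.
have phi0 : phi 0 = 0 by apply: (addrI (phi 0)); rewrite -phiD !addr0.
rewrite -[x]reprK tensor_lift_pi // pi_tensor_sum.
rewrite (big_morph phi phiD phi0).
by apply: eq_bigr => p _; rewrite phiE.
Qed.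

End Tensor.

Definition tensor_map (R : pzRingType) (A B : lmodType R^c) (F : lmodType R)
    (i : {linear A -> B}) : tensor A F -> tensor B F :=
  tensor_lift (fun a f => tens (i a) f).

Lemma tensor_map_balanced (R : pzRingType) (A B : lmodType R^c)
    (F : lmodType R) (i : {linear A -> B}) :
  balanced (fun a (f : F) => tens (i a) f).
Proof.
have [tDl tDr tZ] := tens_balanced B F.
by split=> *; rewrite ?linearD ?linearZ /= ?tDl ?tDr ?tZ.
Qed.

Definition flat (R : pzRingType) (F : lmodType R) : Prop :=
  forall (A B : lmodType R^c) (i : {linear A -> B}),
    injective i -> injective (@tensor_map R A B F i).

Definition flat_precover (R : pzRingType) (F N : lmodType R)
    (g : {linear F -> N}) : Prop :=
  flat F /\
  forall (F' : lmodType R), flat F' ->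
    forall u : {linear F' -> N}, exists v : {linear F' -> F}, g \o v =1 u.

Definition flat_precover_completing_domain (R : pzRingType)
    (M N : lmodType R) : Prop :=
  forall (f : {linear M -> N}) (F : lmodType R) (g : {linear F -> N}),
    flat_precover g -> exists h : {linear M -> F}, g \o h =1 f.

Definition subprojectivity_domain (R : pzRingType) (M N : lmodType R) : Prop :=
  forall (B : lmodType R) (g : {linear B -> N}) (f : {linear M -> N}),
    (forall y, exists x, g x = y) -> exists h : {linear M -> B}, g \o h =1 f.

(* Main.v *)
Require Import Defs.
From HB Require Import structures.
From mathcomp Require Import all_boot all_order all_algebra.
From mathcomp Require Import boolp classical_sets.

Set Implicit Arguments.
Unset Strict Implicit.
Unset Printing Implicit Defensive.

Import GRing.Theory.
Local Open Scope ring_scope.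
Local Open Scope quotient_scope.

(* The crux is that every module N has a flat precover; the two inclusions are
   then formal (flat precovers are onto because R is flat, and a lifting along
   an epimorphism B -> N is obtained from the pullback with a flat precover).

   Flatness is handled through the equational criterion, and [pure] means
   P :&: I F = I P for right ideals I, which suffices for F / P to be flat when F
   is.  Precovers exist because every morphism f : F -> N with F flat factors
   through a flat quotient of F that is an image of the type [tree N], which does
   not depend on F; the direct sum of representatives of all such quotients is a
   precover.  By Zorn it is enough to find a nonzero pure submodule of ker f
   whenever the image Y of [tree N] in F is not all of F.  Starting from x0
   outside Y, close {x0} under linear combinations, under solving equations
   p = sum r_i w_i, and under picking, when p is congruent to an element of Y
   modulo I F, such an element.  The resulting small module X has by construction
   of [tree] a copy X -> Y, x |-> x', over X :&: Y and over N.  Then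
   Q = { x - x' } lies in ker f and is nonzero.  It is pure: if x - x' is in I F
   then x is congruent to some z in X :&: Y modulo I F, so x - z is in I X and
   x - x' = (x - z) - (x - z)' is in I Q. *)

(** * Linear maps and submodules *)

Lemma linear_bundle (R : pzRingType) (U V : lmodType R) (f : U -> V) :
  linear f -> exists g : {linear U -> V}, g =1 f.
Proof.
move=> fL.
pose m := GRing.isLinear.Build R U V _ f fL.
by exists (HB.pack_for {linear U -> V} f m).
Qed.

Definition is_submod (R : pzRingType) (V : lmodType R) (P : V -> Prop) : Prop :=
  P 0 /\ forall r x y, P x -> P y -> P (r *: x + y).

Section Submodule.
Variables (R : pzRingType) (V : lmodType R) (P : V -> Prop).

(** The closure proof is carried as an argument so that the submodule structure below can be
    attached to the predicate. *)
Definition submod_pred (Psub : is_submod P) : {pred V} := fun x => `[< P x >].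

Variable Psub : is_submod P.

Lemma submod_pred_closed : submod_closed (submod_pred Psub).
Proof.
have [P0 PL] := Psub; split; first exact/asboolP.
by move=> r x y /asboolP Px /asboolP Py; apply/asboolP; exact: PL.
Qed.

HB.instance Definition _ :=
  GRing.isSubmodClosed.Build R V (submod_pred Psub) submod_pred_closed.

Record submodule := Submodule {
  submod_val : V;
  submod_valP : submod_val \in submod_pred Psub }.

HB.instance Definition _ := [isSub for submod_val].
HB.instance Definition _ := [Choice of submodule by <:].
HB.instance Definition _ := [SubChoice_isSubLmodule of submodule by <:].

Lemma submod_val_linear : linear submod_val.
Proof. by []. Qed.

Lemma submod_val_inj : injective submod_val.
Proof. exact: val_inj. Qed.

Lemma submod_prop (x : submodule) : P (submod_val x).
Proof. exact/asboolP/(submod_valP x). Qed.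

Definition submod_of (x : V) (Px : P x) : submodule := Submodule (asboolT Px).

End Submodule.

(** * Quotient modules *)

Section Quotient.
Variables (R : pzRingType) (V : lmodType R) (P : V -> Prop).
Variable Psub : is_submod P.

Definition quot_rel (_ : is_submod P) : rel V := fun x y => `[< P (x - y) >].

Lemma submodN x : P x -> P (- x).
Proof.
by have [P0 PL] := Psub; move=> Px; rewrite -scaleN1r -[_ *: _]addr0; exact: PL.
Qed.

Lemma submodD x y : P x -> P y -> P (x + y).
Proof. by have [P0 PL] := Psub; rewrite -{2}[x]scale1r; exact: PL. Qed.

Lemma submodZ r x : P x -> P (r *: x).
Proof. by have [P0 PL] := Psub; rewrite -[_ *: _]addr0 => ?; exact: PL. Qed.

Lemma quot_rel_refl : reflexive (quot_rel Psub).
Proof. by move=> x; apply/asboolP; rewrite subrr; case: Psub. Qed.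

Lemma quot_rel_sym : symmetric (quot_rel Psub).
Proof.
by move=> x y; apply/asboolP/asboolP => /submodN; rewrite opprB.
Qed.

Lemma quot_rel_trans : transitive (quot_rel Psub).
Proof.
move=> y x z /asboolP xy /asboolP yz; apply/asboolP.
by have := submodD xy yz; rewrite addrA subrK.
Qed.

Canonical quot_equiv_rel :=
  EquivRel (quot_rel Psub) quot_rel_refl quot_rel_sym quot_rel_trans.

Definition quot_mod : Type := {eq_quot quot_equiv_rel}.

HB.instance Definition _ := Choice.on quot_mod.
HB.instance Definition _ := EqQuotient.on quot_mod.

Definition quot_pi (x : V) : quot_mod := \pi_quot_mod x.

Lemma quot_piP x y : quot_pi x = quot_pi y <-> P (x - y).
Proof.
split=> [/(@eqquotP _ (quot_rel Psub) quot_mod) /asboolP //|].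
by move=> Pxy; apply/(@eqquotP _ (quot_rel Psub) quot_mod)/asboolP.
Qed.

Lemma quot_repr x : P (repr (quot_pi x) - x).
Proof. by apply/quot_piP; rewrite /quot_pi reprK. Qed.

Lemma quot_pi_surj (x : quot_mod) : exists v, quot_pi v = x.
Proof. by exists (repr x); rewrite /quot_pi reprK. Qed.

Definition quot_add (x y : quot_mod) : quot_mod := quot_pi (repr x + repr y).
Definition quot_opp (x : quot_mod) : quot_mod := quot_pi (- repr x).
Definition quot_scale (r : R) (x : quot_mod) : quot_mod := quot_pi (r *: repr x).

Lemma quot_addE x y : quot_add (quot_pi x) (quot_pi y) = quot_pi (x + y).
Proof.
by apply/quot_piP; rewrite opprD addrACA; apply: submodD; exact: quot_repr.
Qed.

Lemma quot_oppE x : quot_opp (quot_pi x) = quot_pi (- x).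
Proof. by apply/quot_piP; rewrite -opprD; apply: submodN; exact: quot_repr. Qed.

Lemma quot_scaleE r x : quot_scale r (quot_pi x) = quot_pi (r *: x).
Proof. by apply/quot_piP; rewrite -scalerBr; apply: submodZ; exact: quot_repr. Qed.

Lemma quot_addA : associative quot_add.
Proof.
move=> x y z; have [u <-] := quot_pi_surj x; have [v <-] := quot_pi_surj y.
by have [w <-] := quot_pi_surj z; rewrite !quot_addE addrA.
Qed.

Lemma quot_addC : commutative quot_add.
Proof. by move=> x y; rewrite /quot_add addrC. Qed.

Lemma quot_add0 : left_id (quot_pi 0) quot_add.
Proof. by move=> x; have [u <-] := quot_pi_surj x; rewrite quot_addE add0r. Qed.

Lemma quot_addN : left_inverse (quot_pi 0) quot_opp quot_add.
Proof.
move=> x; have [u <-] := quot_pi_surj x.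
by rewrite quot_oppE quot_addE addNr.
Qed.

HB.instance Definition _ := GRing.isZmodule.Build quot_mod
  quot_addA quot_addC quot_add0 quot_addN.

Lemma quot_scaleA r s x : quot_scale r (quot_scale s x) = quot_scale (r * s) x.
Proof.
by have [u <-] := quot_pi_surj x; rewrite !quot_scaleE scalerA.
Qed.

Lemma quot_scale1 : left_id 1 quot_scale.
Proof. by move=> x; have [u <-] := quot_pi_surj x; rewrite quot_scaleE scale1r. Qed.

Lemma quot_scaleDr : right_distributive quot_scale +%R.
Proof.
move=> r x y; have [u <-] := quot_pi_surj x; have [v <-] := quot_pi_surj y.
by rewrite [_ + _]quot_addE !quot_scaleE [RHS]quot_addE scalerDr.
Qed.

Lemma quot_scaleDl x : {morph quot_scale^~ x : r s / r + s}.
Proof.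
move=> r s /=; have [u <-] := quot_pi_surj x.
by rewrite !quot_scaleE [RHS]quot_addE scalerDl.
Qed.

HB.instance Definition _ := GRing.Zmodule_isLmodule.Build R quot_mod
  quot_scaleA quot_scale1 quot_scaleDr quot_scaleDl.

Lemma quot_pi_linear : linear quot_pi.
Proof. by move=> r x y; rewrite -quot_addE -quot_scaleE. Qed.

HB.instance Definition _ :=
  GRing.isLinear.Build R V quot_mod _ quot_pi quot_pi_linear.

Lemma quot_lift (W : lmodType R) (f : {linear V -> W}) :
  (forall x, P x -> f x = 0) ->
  exists g : {linear quot_mod -> W}, forall x, g (quot_pi x) = f x.
Proof.
move=> f0; have fpi x : f (repr (quot_pi x)) = f x.
  by apply/eqP; rewrite -subr_eq0 -linearB f0 //; exact: quot_repr.
have [g gE] : exists g : {linear quot_mod -> W}, g =1 f \o repr.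
  apply: linear_bundle => r x y.
  have [u <-] := quot_pi_surj x; have [v <-] := quot_pi_surj y.
  by rewrite -linearP /= !fpi linearP.
by exists g => x; rewrite gE /= fpi.
Qed.

End Quotient.

(** * Direct products and families of finite support *)

Section DirectProduct.
Variables (R : pzRingType) (I : Type) (G : I -> lmodType R).

Definition dprod : Type := forall i, G i.

HB.instance Definition _ := gen_eqMixin dprod.
HB.instance Definition _ := gen_choiceMixin dprod.

Definition dprod_add (x y : dprod) : dprod := fun i => x i + y i.
Definition dprod_opp (x : dprod) : dprod := fun i => - x i.
Definition dprod_zero : dprod := fun i => 0.
Definition dprod_scale (r : R) (x : dprod) : dprod := fun i => r *: x i.

Lemma dprod_addA : associative dprod_add.
Proof. by move=> x y z; apply: functional_extensionality_dep => i; rewrite /dprod_add addrA. Qed.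
Lemma dprod_addC : commutative dprod_add.
Proof. by move=> x y; apply: functional_extensionality_dep => i; rewrite /dprod_add addrC. Qed.
Lemma dprod_add0 : left_id dprod_zero dprod_add.
Proof. by move=> x; apply: functional_extensionality_dep => i; rewrite /dprod_add add0r. Qed.
Lemma dprod_addN : left_inverse dprod_zero dprod_opp dprod_add.
Proof. by move=> x; apply: functional_extensionality_dep => i; rewrite /dprod_add addNr. Qed.

HB.instance Definition _ := GRing.isZmodule.Build dprod
  dprod_addA dprod_addC dprod_add0 dprod_addN.

Lemma dprod_scaleA r s x : dprod_scale r (dprod_scale s x) = dprod_scale (r * s) x.
Proof. by apply: functional_extensionality_dep => i; rewrite /dprod_scale scalerA. Qed.
Lemma dprod_scale1 : left_id 1 dprod_scale.
Proof. by move=> x; apply: functional_extensionality_dep => i; rewrite /dprod_scale scale1r. Qed.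
Lemma dprod_scaleDr : right_distributive dprod_scale +%R.
Proof. by move=> r x y; apply: functional_extensionality_dep => i; rewrite /dprod_scale scalerDr. Qed.
Lemma dprod_scaleDl x : {morph dprod_scale^~ x : r s / r + s}.
Proof. by move=> r s; apply: functional_extensionality_dep => i; rewrite /dprod_scale scalerDl. Qed.

HB.instance Definition _ := GRing.Zmodule_isLmodule.Build R dprod
  dprod_scaleA dprod_scale1 dprod_scaleDr dprod_scaleDl.

Lemma dprod_linE (r : R) (x y : dprod) i : (r *: x + y) i = r *: x i + y i.
Proof. by []. Qed.

Definition dprod_inj i (x : G i) : dprod := fun j =>
  match pselect (i = j) with
  | left e => ecast j (G j) e x
  | right _ => 0
  end.

Lemma dprod_inj_eq i (x : G i) : dprod_inj x i = x.
Proof.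
rewrite /dprod_inj; case: pselect => // e.
by rewrite (Prop_irrelevance e erefl).
Qed.

Lemma dprod_inj_neq i (x : G i) j : i <> j -> dprod_inj x j = 0.
Proof. by rewrite /dprod_inj; case: pselect. Qed.

Lemma dprod_inj_linear i : linear (@dprod_inj i).
Proof.
move=> r x y; apply: functional_extensionality_dep => j; rewrite dprod_linE.
have [e|ne] := pselect (i = j).
  by case: j / e; rewrite !dprod_inj_eq.
by rewrite !dprod_inj_neq // scaler0 addr0.
Qed.

Definition supp_in (s : seq {classic I}) (x : dprod) : Prop :=
  forall i : {classic I}, i \notin s -> x i = 0.

Definition finsupp (x : dprod) : Prop := exists s, supp_in s x.

Lemma finsupp_submod : is_submod finsupp.
Proof.
split; first by exists [::].
move=> r x y [s sx] [t ty]; exists (s ++ t) => i.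
rewrite mem_cat negb_or => /andP[/sx xi /ty yi].
by rewrite dprod_linE xi yi scaler0 addr0.
Qed.

End DirectProduct.

(** * Linear combinations and trivial relations *)

Section LinearCombinations.
Variables (R : pzRingType) (F : lmodType R).

Definition lincomb n (r : 'rV[R]_n) (y : 'I_n -> F) : F :=
  \sum_i r 0 i *: y i.

Lemma lincombDl n (r s : 'rV[R]_n) y : lincomb (r + s) y = lincomb r y + lincomb s y.
Proof. by rewrite -big_split; apply: eq_bigr => i _; rewrite mxE scalerDl. Qed.

Lemma lincombDr n (r : 'rV[R]_n) y z :
  lincomb r (fun i => y i + z i) = lincomb r y + lincomb r z.
Proof. by rewrite -big_split; apply: eq_bigr => i _; rewrite scalerDr. Qed.

Lemma lincombNl n (r : 'rV[R]_n) y : lincomb (- r) y = - lincomb r y.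
Proof. by rewrite -sumrN; apply: eq_bigr => i _; rewrite mxE scaleNr. Qed.

Lemma lincombNr n (r : 'rV[R]_n) y :
  lincomb r (fun i => - y i) = - lincomb r y.
Proof. by rewrite -sumrN; apply: eq_bigr => i _; rewrite scalerN. Qed.

Lemma eq_lincomb n (r : 'rV[R]_n) y z : y =1 z -> lincomb r y = lincomb r z.
Proof. by move=> yz; apply: eq_bigr => i _; rewrite yz. Qed.

Lemma lincomb_row_mx n p (r : 'rV[R]_n) (s : 'rV[R]_p) (y : 'I_(n + p) -> F) :
  lincomb (row_mx r s) y =
  lincomb r (fun i => y (lshift p i)) + lincomb s (fun i => y (rshift n i)).
Proof.
rewrite /lincomb big_split_ord /=.
by congr (_ + _); apply: eq_bigr => i _; rewrite ?row_mxEl ?row_mxEr.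
Qed.

Lemma lincomb_mul n k (r : 'rV[R]_n) (A : 'M[R]_(n, k)) y :
  lincomb (r *m A) y = lincomb r (fun i => lincomb (row i A) y).
Proof.
rewrite /lincomb; under eq_bigr => j _ do rewrite mxE scaler_suml.
rewrite exchange_big /=; apply: eq_bigr => i _; rewrite scaler_sumr.
by apply: eq_bigr => j _; rewrite !mxE scalerA.
Qed.

Definition fcat n p (u : 'I_n -> F) (v : 'I_p -> F) (i : 'I_(n + p)) : F :=
  match fintype.split i with inl i => u i | inr i => v i end.

Lemma lincomb_fcat n p (r : 'rV[R]_n) (s : 'rV[R]_p) u v :
  lincomb (row_mx r s) (fcat u v) = lincomb r u + lincomb s v.
Proof.
rewrite lincomb_row_mx; congr (_ + _); apply: eq_lincomb => j; rewrite /fcat.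
  by rewrite (unsplitK (inl j)).
by rewrite (unsplitK (inr j)).
Qed.

(** The trivial relations of the equational criterion: with [x] and [y] read as columns, [x = A y]
    and [r A = 0], so [r x = 0] follows from relations among scalars. *)
Definition vanishing n (r : 'rV[R]_n) (x : 'I_n -> F) : Prop :=
  exists k (A : 'M[R]_(n, k)) (y : 'I_k -> F),
    (forall i, x i = lincomb (row i A) y) /\ r *m A = 0.

Lemma vanishing0 n (r : 'rV[R]_n) : vanishing r (fun=> 0).
Proof.
exists 0, 0, (fun=> 0); split=> [i|]; last by rewrite mulmx0.
by rewrite /lincomb big_ord0.
Qed.

Lemma eq_vanishing n (r : 'rV[R]_n) x y : x =1 y -> vanishing r x -> vanishing r y.
Proof. by move=> /funext->. Qed.

Lemma vanishingD n (r : 'rV[R]_n) x y :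
  vanishing r x -> vanishing r y -> vanishing r (fun i => x i + y i).
Proof.
move=> [k [A [u [xE rA]]]] [l [B [v [yE rB]]]].
exists (k + l)%N, (row_mx A B), (fcat u v).
split=> [i|]; last by rewrite mul_mx_row rA rB row_mx0.
by rewrite row_row_mx lincomb_fcat xE yE.
Qed.

Lemma vanishingN n (r : 'rV[R]_n) x : vanishing r x -> vanishing r (fun i => - x i).
Proof.
move=> [k [A [u [xE rA]]]]; exists k, A, (fun i => - u i); split=> // i.
by rewrite lincombNr xE.
Qed.

Lemma vanishing_scale n (r : 'rV[R]_n) (c : 'cV[R]_n) f :
  r *m c = 0 -> vanishing r (fun i => c i 0 *: f).
Proof.
move=> rc; exists 1%N, c, (fun=> f); split=> // i.
by rewrite /lincomb big_ord1 mxE.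
Qed.

Lemma vanishing_sum n (r : 'rV[R]_n) (J : Type) (s : seq J) (x : J -> 'I_n -> F) :
  (forall j, vanishing r (x j)) -> vanishing r (fun i => \sum_(j <- s) x j i).
Proof.
move=> xv; elim: s => [|j s IH].
  by apply: eq_vanishing (vanishing0 r) => i; rewrite big_nil.
by apply: eq_vanishing (vanishingD (xv j) IH) => i; rewrite big_cons.
Qed.

Definition equational_flat : Prop :=
  forall n (r : 'rV[R]_n) x, lincomb r x = 0 -> vanishing r x.

End LinearCombinations.

Lemma lincomb_linear (R : pzRingType) (F G : lmodType R) (f : {linear F -> G}) n
    (r : 'rV[R]_n) x : f (lincomb r x) = lincomb r (f \o x).
Proof. by rewrite linear_sum; apply: eq_bigr => i _; rewrite linearZ. Qed.

Lemma vanishing_linear (R : pzRingType) (F G : lmodType R) (f : {linear F -> G}) n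
    (r : 'rV[R]_n) x : vanishing r x -> vanishing r (f \o x).
Proof.
move=> [k [A [y [xE rA]]]]; exists k, A, (f \o y); split=> // i.
by rewrite /= xE lincomb_linear.
Qed.

(** * Flatness implies the equational criterion *)

Section FlatEquational.
Variables (R : pzRingType) (F : lmodType R).
Hypothesis Fflat : flat F.
Variables (n : nat) (r : 'rV[R]_n) (x : 'I_n -> F).
Hypothesis rx : lincomb r x = 0.

(** The right ideal generated by the entries of [r], inside the regular module over [R^c]. *)
Let ideal (b : (R^c)^o) : Prop := exists c : 'cV[R]_n, b = (r *m c) 0 0 :> R.

Lemma ideal_submod : is_submod ideal.
Proof.
split; first by exists 0; rewrite mulmx0 mxE.
move=> s a b [c ->] [d ->].
exists ((\col_i (c i 0 * s)) + d); rewrite mulmxDr [RHS]mxE; congr (_ + _).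
rewrite !mxE [LHS]/GRing.scale /= [LHS]mulr_suml; apply: eq_bigr => i _.
by rewrite !mxE mulrA.
Qed.

Let I := submodule ideal_submod.

Let coef (a : I) : 'cV[R]_n := sval (cid (submod_prop a)).

Lemma coefP (a : I) : submod_val a = (r *m coef a) 0 0.
Proof. by rewrite /coef; case: cid. Qed.

(** The tuple in F^n read off from a word through [coef]. As [coef] is an arbitrary choice, a tensor
    determines this tuple only up to vanishing families. *)
Let word_coef (s : seq (I * F)) (i : 'I_n) : F := \sum_(p <- s) coef p.1 i 0 *: p.2.

Lemma coef_ker (c : 'cV[R]_n) : (r *m c) 0 0 = 0 -> r *m c = 0.
Proof. by move=> h; apply/matrixP => i j; rewrite !ord1 h mxE. Qed.

(** The failures of [coef] to respect zero, sums and scalars are columns killed by [r], so each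
    generating relation of the tensor product changes the tuple by a vanishing family. *)
Lemma tensor_eqv_vanishing s t : tensor_eqv s t ->
  vanishing r (fun i => word_coef s i - word_coef t i).
Proof.
have subE (A B : 'M[R]_1) : (A - B) 0 0 = A 0 0 - B 0 0 by rewrite !mxE.
elim=> {s t}.
- by move=> s; apply: eq_vanishing (vanishing0 _ r) => i; rewrite subrr.
- move=> s t _ /vanishingN; apply: eq_vanishing => i; by rewrite opprB.
- move=> t s u _ h1 _ h2; apply: eq_vanishing (vanishingD h1 h2) => i.
  by rewrite addrA subrK.
- move=> s s' t t' _ h1 _ h2; apply: eq_vanishing (vanishingD h1 h2) => i.
  by rewrite /word_coef !big_cat /= opprD addrACA.
- move=> s t; apply: eq_vanishing (vanishing0 _ r) => i.
  by rewrite /word_coef !big_cat /= [X in _ - X]addrC subrr.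
- move=> f; have h : r *m coef 0 = 0 by apply: coef_ker; rewrite -coefP.
  apply: eq_vanishing (vanishing_scale f h) => i.
  by rewrite /word_coef big_seq1 big_nil subr0.
- move=> a a' f.
  have h : r *m (coef (a + a') - coef a - coef a') = 0.
    apply: coef_ker; rewrite !mulmxBr !subE -!coefP.
    rewrite -addrA -opprD; apply/eqP; rewrite subr_eq0; apply/eqP.
    have := submod_val_linear 1 a a'; by rewrite !scale1r.
  apply: eq_vanishing (vanishing_scale f h) => i.
  rewrite /word_coef big_seq1 !big_cons big_nil /= addr0 !mxE.
  by rewrite !scalerBl -addrA -opprD.
- move=> a f f'; apply: eq_vanishing (vanishing0 _ r) => i.
  by rewrite /word_coef big_seq1 !big_cons big_nil /= addr0 scalerDr subrr.
- move=> a s f.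
  have h : r *m (coef ((s : R^c) *: a) - (\col_i (coef a i 0 * s))) = 0.
    apply: coef_ker; rewrite mulmxBr subE -coefP.
    have -> : submod_val ((s : R^c) *: a) = (submod_val a : R) * s :> R by [].
    rewrite coefP !mxE mulr_suml; apply/eqP; rewrite subr_eq0; apply/eqP.
    by apply: eq_bigr => i _; rewrite mxE mulrA.
  apply: eq_vanishing (vanishing_scale f h) => i.
  by rewrite /word_coef !big_seq1 /= !mxE scalerBl scalerA.
Qed.

Lemma ideal_gen i : ideal (r 0 i).
Proof. by exists (delta_mx i 0); rewrite -colE mxE. Qed.

(** The sum of the [r_i] tensored with the [x_i] equals 1 tensored with [lincomb r x] over the whole
    ring, hence is zero there. By flatness it is zero over the ideal too, and its tuple is [x] up to
    a vanishing family. *)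
Lemma flat_vanishing : vanishing r x.
Proof.
have [inc incE] := linear_bundle (@submod_val_linear _ _ _ ideal_submod).
have inc_inj : injective inc.
  by move=> a b; rewrite !incE; exact: submod_val_inj.
pose g i : I := submod_of ideal_submod (ideal_gen i).
pose s := [seq (g i, x i) | i <- enum 'I_n].
have [tDl tDr tZ] := tens_balanced ((R^c)^o) F.
have s0 : \pi_(tensor I F) s = \pi_(tensor I F) [::].
  apply: (Fflat inc_inj).
  rewrite /tensor_map !tensor_lift_pi; try exact: tensor_map_balanced.
  rewrite big_nil big_map big_enum /=.
  have t0 : tens (1 : (R^c)^o) (0 : F) = 0.
    by apply: (addrI (tens (1 : (R^c)^o) (0 : F))); rewrite -tDr !addr0.
  transitivity (tens (1 : (R^c)^o) (lincomb r x)); last by rewrite rx t0.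
  rewrite (big_morph _ (tDr 1) t0); apply: eq_bigr => i _.
  by rewrite -tZ incE /=; congr tens; rewrite [RHS]/GRing.scale /= [RHS]mul1r.
have /tensor_piP/asboolP/tensor_eqv_vanishing h := s0.
(* The unit column at [k] and [coef (g k)] both express [r 0 k]; their difference is killed by [r]
   and corrects the tuple of [s] to [x]. *)
have h2 : vanishing r (fun i => \sum_(k <- enum 'I_n)
   (delta_mx k 0 - coef (g k) : 'cV[R]_n) i 0 *: x k).
  apply: vanishing_sum => k; apply: vanishing_scale; apply: coef_ker.
  by rewrite mulmxBr mxE -colE mxE [X in _ + X]mxE -coefP /= subrr.
apply: eq_vanishing (vanishingD h h2) => i.
rewrite /word_coef big_nil subr0 big_map -big_split /= big_enum /=.
rewrite (bigD1 i) //= big1 => [|k ki].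
  by rewrite !mxE !eqxx scalerBl scale1r addrCA subrr !addr0.
by rewrite !mxE eq_sym (negbTE ki) sub0r scaleNr subrr.
Qed.

End FlatEquational.

(** * The equational criterion implies flatness *)

Section EquationalFlat.
Variables (R : pzRingType) (F : lmodType R).
Hypothesis Feq : equational_flat F.

Section Lifts.
Variable B : lmodType R^c.

(** A word over [B * 'rV_m] presents an element of B tensored with R^m; [y] gives the map from R^m
    to F along which it is pushed. *)
Definition word_val m (y : 'I_m -> F) (s : seq (B * 'rV[R]_m)) : seq (B * F) :=
  [seq (p.1, lincomb p.2 y) | p <- s].

Definition word_mul m k (A : 'M[R]_(m, k)) (s : seq (B * 'rV[R]_m)) :
  seq (B * 'rV[R]_k) := [seq (p.1, p.2 *m A) | p <- s].

(** The same element seen in B^m, where equality is tested coordinatewise. *)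
Definition word_sum m (s : seq (B * 'rV[R]_m)) (j : 'I_m) : B :=
  \sum_(p <- s) (p.2 0 j : R^c) *: p.1.

Lemma word_val_mul m k (A : 'M[R]_(m, k)) y y' s :
  (forall i, y i = lincomb (row i A) y') ->
  word_val y' (word_mul A s) = word_val y s.
Proof.
move=> yE; rewrite /word_val /word_mul -map_comp; apply: eq_map => p /=.
by rewrite lincomb_mul; congr pair; apply: eq_lincomb => i; rewrite yE.
Qed.

Lemma word_sum_mul m k (A : 'M[R]_(m, k)) s j :
  word_sum (word_mul A s) j = \sum_i (A i j : R^c) *: word_sum s i.
Proof.
rewrite /word_sum big_map /=; under [RHS]eq_bigr => i _ do rewrite scaler_sumr.
rewrite exchange_big /=; apply: eq_bigr => p _.
have -> : (p.2 *m A) 0 j = \sum_i (A i j : R^c) * (p.2 0 i : R^c) :> R^c.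
  by rewrite mxE.
by rewrite scaler_suml; apply: eq_bigr => i _; rewrite scalerA.
Qed.

(** Two lifts of one word agree over a common refinement of their families. For empty words
    concatenating the families suffices; at each further letter the two rows have the same value in
    F, and the criterion yields [C] killing their difference. *)
Lemma lift_amalgam m m' (y : 'I_m -> F) (y' : 'I_m' -> F) T T' :
  word_val y T = word_val y' T' ->
  exists k (A : 'M[R]_(m, k)) (A' : 'M[R]_(m', k)) (z : 'I_k -> F),
    [/\ forall i, y i = lincomb (row i A) z,
        forall i, y' i = lincomb (row i A') z &
        word_mul A T = word_mul A' T'].
Proof.
elim: T T' => [|[b c] T IH] [|[b' c'] T'] //=.
  move=> _; exists (m + m')%N, (row_mx 1%:M 0), (row_mx 0 1%:M), (fcat y y').
  have lin1 p (u : 'I_p -> F) i : u i = lincomb (row i 1%:M) u.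
    rewrite /lincomb (bigD1 i) //= big1 ?addr0; last first.
      by move=> j ji; rewrite !mxE eq_sym (negbTE ji) scale0r.
    by rewrite !mxE eqxx scale1r.
  have lin0 p (u : 'I_p -> F) : lincomb (0 : 'rV_p) u = 0.
    by rewrite /lincomb big1 // => j _; rewrite mxE scale0r.
  by split=> // i; rewrite row_row_mx lincomb_fcat row0 lin0 ?addr0 ?add0r -lin1.
move=> [bb cc] /IH[k [A [A' [z [yE y'E TT']]]]]; subst b'.
have : lincomb (c *m A - c' *m A') z = 0.
  rewrite lincombDl lincombNl !lincomb_mul.
  rewrite -(eq_lincomb c yE) -(eq_lincomb c' y'E).
  by move: cc; rewrite /= => ->; rewrite subrr.
move=> /Feq[l [C [w [zE CE]]]].
exists l, (A *m C), (A' *m C), w; split.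
- by move=> i; rewrite yE row_mul lincomb_mul; apply: eq_lincomb.
- by move=> i; rewrite y'E row_mul lincomb_mul; apply: eq_lincomb.
- congr cons.
    by congr pair; apply/eqP; rewrite -subr_eq0 !mulmxA -mulmxBl CE.
  have comp p (D : 'M[R]_(p, k)) U : word_mul (D *m C) U = word_mul C (word_mul D U).
    by rewrite /word_mul -map_comp; apply: eq_map => q /=; rewrite mulmxA.
  by rewrite -!/(word_mul _ _) !comp TT'.
Qed.

(* An equality of tensors in B (x) F already holds in B (x) R^m for some map
   R^m -> F; transitivity is where the equational criterion is needed. *)
Definition liftable (s t : seq (B * F)) : Prop :=
  exists m (y : 'I_m -> F) S T,
    [/\ word_val y S = s, word_val y T = t & word_sum S =1 word_sum T].

Lemma liftable_cat s s' t t' :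
  liftable s s' -> liftable t t' -> liftable (s ++ t) (s' ++ t').
Proof.
move=> [m [y [S [S' [<- <- SS']]]]] [m' [y' [T [T' [<- <- TT']]]]].
(* The words are empty because only a common family for [y] and [y'] is wanted. *)
have [k [A [A' [z [yE y'E _]]]]] := @lift_amalgam _ _ y y' [::] [::] erefl.
exists k, z, (word_mul A S ++ word_mul A' T), (word_mul A S' ++ word_mul A' T').
split; first by rewrite /word_val map_cat -!/(word_val _ _) !(word_val_mul _ yE, word_val_mul _ y'E).
  by rewrite /word_val map_cat -!/(word_val _ _) !(word_val_mul _ yE, word_val_mul _ y'E).
move=> j; rewrite /word_sum !big_cat /= -!/(word_sum _ _) !word_sum_mul.
by congr (_ + _); apply: eq_bigr => i _; rewrite ?SS' ?TT'.
Qed.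

Lemma liftable_trans t s u : liftable s t -> liftable t u -> liftable s u.
Proof.
move=> [m [y [S [T [<- tE ST]]]]] [m' [y' [T' [U [t'E <- TU]]]]].
have [k [A [A' [z [yE y'E TT']]]]] := lift_amalgam (etrans tE (esym t'E)).
exists k, z, (word_mul A S), (word_mul A' U); split.
- exact: word_val_mul.
- exact: word_val_mul.
- move=> j; rewrite word_sum_mul; under eq_bigr => i _ do rewrite ST.
  rewrite -word_sum_mul TT' !word_sum_mul.
  by apply: eq_bigr => i _; rewrite TU.
Qed.

Lemma word_lift s : exists m (y : 'I_m -> F) S, word_val y S = s.
Proof.
suff [m [y [S [_ [<- _ _]]]]] : liftable s s by exists m, y, S.
elim: s => [|[b f] s IH]; first by exists 0%N, (fun=> 0), [::], [::].
rewrite -cat1s; apply: liftable_cat => //.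
exists 1%N, (fun=> f), [:: (b, 1%:M)], [:: (b, 1%:M)]; split=> //;
  by rewrite /word_val /= /lincomb big_ord1 mxE eqxx scale1r.
Qed.

Lemma tensor_eqv_liftable s t : tensor_eqv s t -> liftable s t.
Proof.
elim=> {s t}.
- by move=> s; have [m [y [S <-]]] := word_lift s; exists m, y, S, S.
- move=> s t _ [m [y [S [T [<- <- ST]]]]].
  by exists m, y, T, S; split=> // j; rewrite ST.
- by move=> t s u _ + _; exact: liftable_trans.
- by move=> s s' t t' _ + _; exact: liftable_cat.
- move=> s t; have [m [y [S SE]]] := word_lift (s ++ t).
  exists m, y, S, (drop (size s) S ++ take (size s) S); split=> //.
    rewrite /word_val map_cat map_drop map_take -/(word_val _ _) SE.
    by rewrite drop_size_cat // take_size_cat.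
  move=> j; rewrite /word_sum big_cat /= addrC -big_cat /= cat_take_drop //.
- move=> f; exists 1%N, (fun=> f), [:: (0, 1%:M)], [::]; split=> //.
    by rewrite /word_val /= /lincomb big_ord1 mxE eqxx scale1r.
  by move=> j; rewrite /word_sum big_seq1 big_nil /= scaler0.
- move=> a a' f; exists 1%N, (fun=> f), [:: (a + a', 1%:M)],
    [:: (a, 1%:M); (a', 1%:M)]; split.
  + by rewrite /word_val /= /lincomb big_ord1 mxE eqxx scale1r.
  + by rewrite /word_val /= /lincomb big_ord1 mxE eqxx scale1r.
  + by move=> j; rewrite /word_sum big_seq1 !big_cons big_nil /= addr0 scalerDr.
- move=> a f f'.
  have l2 (c : 'rV[R]_2) : lincomb c (fun i => if i == 0 then f else f') =
      c 0 0 *: f + c 0 1 *: f'.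
    by rewrite /lincomb big_ord_recl big_ord1 /=; congr (_ + c 0 _ *: _); apply/val_inj.
  exists 2%N, (fun i => if i == 0 then f else f'), [:: (a, const_mx 1)],
    [:: (a, delta_mx 0 0); (a, delta_mx 0 1)]; split.
  + by rewrite /word_val /= l2 !mxE !scale1r.
  + by rewrite /word_val /= !l2 !mxE /= !scale1r !scale0r addr0 add0r.
  + move=> j; rewrite /word_sum big_seq1 !big_cons big_nil /= addr0 -scalerDl.
    congr (_ *: _); rewrite !mxE eqxx /=.
    by case/boolP: (j == 0) => [/eqP->|]; case: j => [[|[|]]] //= *; rewrite ?addr0 ?add0r.
- move=> a r f; exists 1%N, (fun=> f), [:: ((r : R^c) *: a, 1%:M)],
    [:: (a, r%:M)]; split.
  + by rewrite /word_val /= /lincomb big_ord1 mxE eqxx scale1r.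
  + by rewrite /word_val /= /lincomb big_ord1 mxE eqxx.
  + by move=> j; rewrite /word_sum !big_seq1 /= !ord1 !mxE eqxx [LHS]scale1r.
Qed.

End Lifts.

(** If the image of a tensor under [i] is zero, this already holds in B^m for a suitable lift; the
    lift comes from A^m, where injectivity of [i] applies coordinatewise. *)
Lemma equational_flatP : flat F.
Proof.
move=> A B i i_inj x x'; suff ker0 (z : tensor A F) : tensor_map i z = 0 -> z = 0.
  move=> xx'; apply/eqP; rewrite -subr_eq0; apply/eqP/ker0.
  have mapD := tensor_liftD (tensor_map_balanced F i).
  apply: (addIr (tensor_map i x')).
  by rewrite -mapD subrK add0r.
have [tDl tDr tZ] := tens_balanced A F.
rewrite -[z]reprK; move: (repr z) => s.
rewrite /tensor_map tensor_lift_pi; last exact: tensor_map_balanced.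
rewrite -(big_map (fun p : A * F => (i p.1, p.2)) xpredT (fun p => tens p.1 p.2)).
rewrite -pi_tensor_sum.
move=> /tensor_piP/asboolP/tensor_eqv_liftable.
move=> [m [y [S [T [sE TE S0]]]]]; case: T => // in TE S0 *.
(* Lifting alters only second components, so [S] is the image of a word over [A]. *)
have [S' [SE s'E]] : exists S' : seq (A * 'rV[R]_m),
    S = [seq (i p.1, p.2) | p <- S'] /\ s = word_val y S'.
  elim: S s sE {S0} => [|[b c] S IH] [|[a f] s] //=.
    by exists [::].
  move=> [ba cf] /IH[S' [-> ->]]; exists ((a, c) :: S').
  by rewrite /= ba -cf.
rewrite s'E pi_tensor_sum big_map /=.
have t0l (f : F) : tens (0 : A) f = 0.
  by apply: (addrI (tens (0 : A) f)); rewrite -tDl !addr0.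
have t0r (a : A) : tens a (0 : F) = 0.
  by apply: (addrI (tens a (0 : F))); rewrite -tDr !addr0.
(* Expanding in [y] writes the tensor as the sum over [j] of the coordinate [word_sum S' j] tensored
   with [y j]. *)
under eq_bigr => p _ do rewrite (big_morph _ (tDr p.1) (t0r _)).
rewrite exchange_big big1 //= => j _.
under eq_bigr => p _ do rewrite -tZ.
rewrite -(big_morph (fun a => tens a (y j)) (fun a b => tDl a b _) (t0l _)).
suff -> : \sum_(p <- S') (p.2 0 j : R^c) *: p.1 = 0 by rewrite t0l.
apply: i_inj; rewrite linear0 linear_sum; have := S0 j.
rewrite /word_sum big_nil SE big_map /= => S0j; rewrite -[RHS]S0j.
by apply: eq_bigr => p _; rewrite linearZ.
Qed.

End EquationalFlat.

Theorem flat_iff (R : pzRingType) (F : lmodType R) : flat F <-> equational_flat F.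
Proof.
split=> [Ff n r x|]; first exact: flat_vanishing.
exact: equational_flatP.
Qed.

(** The family [x] is itself a column killed by [r], with 1 as the only generator. *)
Lemma regular_flat (R : pzRingType) : flat (R^o : lmodType R).
Proof.
apply/flat_iff => n r x rx.
apply: eq_vanishing (@vanishing_scale _ _ _ r (\col_i (x i : R)) (1 : R^o) _).
  by move=> i; rewrite mxE [LHS]mulr1.
apply/matrixP => i j; rewrite !ord1 !mxE -[RHS]rx; apply: eq_bigr => k _.
by rewrite mxE.
Qed.

(** * Direct sums of flat modules *)

Section DirectSum.
Variables (R : pzRingType) (I : Type) (G : I -> lmodType R).

Lemma dsum_inj j : exists q : {linear G j -> submodule (finsupp_submod G)},
  forall u, submod_val (q u) = dprod_inj u.
Proof.
have fs (u : G j) : finsupp (dprod_inj u).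
  exists [:: (j : {classic I})] => i; rewrite inE => /eqP ij.
  by apply: dprod_inj_neq => ji; apply: ij.
have [q qE] : exists q : {linear G j -> submodule (finsupp_submod G)},
    q =1 fun u => submod_of (finsupp_submod G) (fs u).
  by apply: linear_bundle => s u v; apply: submod_val_inj; exact: dprod_inj_linear.
by exists q => u; rewrite qE.
Qed.

Lemma dsum_lift (N : lmodType R) (g : forall i, {linear G i -> N}) :
  exists h : {linear submodule (finsupp_submod G) -> N},
    forall i (q : {linear G i -> submodule (finsupp_submod G)}),
      (forall u, submod_val (q u) = dprod_inj u) -> h \o q =1 g i.
Proof.
(* A support list may repeat an index, hence [undup]. *)
pose S (x : dprod G) (s : seq {classic I}) := \sum_(i <- undup s) g i (x i).
have S_indep x s t : supp_in s x -> supp_in t x -> S x s = S x t.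
  have red s' : S x s' = \sum_(i <- [seq i <- undup s' | x i != 0]) g i (x i).
    rewrite big_filter big_mkcond; apply: eq_bigr => i _.
    by case: eqP => //= ->; rewrite linear0.
  move=> sx tx; rewrite !red; apply: (@perm_big _ _ _ {classic I}); apply: uniq_perm.
  - by rewrite filter_uniq ?undup_uniq.
  - by rewrite filter_uniq ?undup_uniq.
  move=> i; rewrite !mem_filter !mem_undup; case: eqP => //= xi.
  have -> : i \in s by apply: contrapT => /negP/sx.
  by apply/esym; apply: contrapT => /negP/tx.
pose supp (u : submodule (finsupp_submod G)) := sval (cid (submod_prop u)).
have suppP u : supp_in (supp u) (submod_val u) by rewrite /supp; case: cid.
have [h hE] : exists h : {linear submodule (finsupp_submod G) -> N},
    h =1 fun u => S (submod_val u) (supp u).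
  apply: linear_bundle => r u v.
  (* One list supporting all three elements makes the sums comparable term by term. *)
  pose s := supp u ++ supp v ++ supp (r *: u + v).
  have supp_s w : {subset supp w <= s} ->
      S (submod_val w) (supp w) = S (submod_val w) s.
    by move=> ws; apply: S_indep => // i iNs; apply: suppP; apply: contra iNs => /ws.
  rewrite !supp_s; first last.
  - by move=> i iw; rewrite !mem_cat iw !orbT.
  - by move=> i iu; rewrite mem_cat iu.
  - by move=> i iv; rewrite !mem_cat iv orbT.
  rewrite submod_val_linear.
  rewrite /S scaler_sumr -big_split; apply: eq_bigr => i _.
  by rewrite dprod_linE linearP.
exists h => i q qE u; rewrite /= hE (S_indep _ _ [:: (i : {classic I})]) //.
  by rewrite qE /S big_seq1 dprod_inj_eq.
rewrite qE => j; rewrite inE => /eqP ji.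
by apply: dprod_inj_neq => ij; apply: ji.
Qed.

(** Induction on a list supporting all the [x i]: removing the coordinate at [j] shortens the list,
    and the removed part is a vanishing family because [G j] is flat. *)
Lemma dsum_flat :
  (forall i, flat (G i)) -> flat (submodule (finsupp_submod G)).
Proof.
move=> Gf; apply/flat_iff => n r x rx.
pose val := @submod_val _ _ _ (finsupp_submod G).
have coord j : exists p : {linear submodule (finsupp_submod G) -> G j},
    p =1 fun u => val u j by apply: linear_bundle.
have [s sx] : exists s, forall i, supp_in s (val (x i)).
  have [t tx] := choice (fun i => submod_prop (x i)).
  exists (flatten [seq t i | i <- enum 'I_n]) => i j js; apply: (tx i).
  apply: contra js => js; apply/flattenP; exists (t i) => //.
  by apply: map_f; rewrite mem_enum.
elim: s x rx sx => [|j s IH] x rx sx.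
  apply: eq_vanishing (vanishing0 _ r) => i; apply: submod_val_inj.
  apply: functional_extensionality_dep => k; exact/esym/sx.
have [p pE] := coord j; have [q qE] := dsum_inj j.
have px : vanishing r (q \o (p \o x)).
  have /flat_iff Gj := Gf j; apply: vanishing_linear; apply: Gj.
  by rewrite -lincomb_linear rx linear0.
have valD u v k : val (u + v) k = val u k + val v k by [].
have valN u k : val (- u) k = - val u k by [].
have : vanishing r (fun i => x i - q (p (x i))).
  apply: IH => [|i k ks].
    have qpx : lincomb r (fun i => q (p (x i))) = q (p (lincomb r x)).
      by rewrite !lincomb_linear.
    by rewrite lincombDr lincombNr qpx rx !linear0 addr0.
  rewrite valD valN /val qE -/val; have [jk|jk] := pselect (j = k).
    by case: k / jk ks => _; rewrite dprod_inj_eq pE subrr.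
  rewrite dprod_inj_neq // subr0 (sx i k) // inE negb_or ks andbT.
  by apply/eqP => kj; apply: jk.
move=> /vanishingD/(_ px); apply: eq_vanishing => i /=.
by rewrite subrK.
Qed.

End DirectSum.

(** * Pure submodules and flat quotients *)

Definition pure (R : pzRingType) (F : lmodType R) (P : F -> Prop) : Prop :=
  forall n (r : 'rV[R]_n) y, P (lincomb r y) ->
    exists w, (forall i, P (w i)) /\ lincomb r w = lincomb r y.

(** A relation in the quotient lifts to [lincomb r y] in [P]. Purity gives [w] in [P] with the same
    combination, and [y - w] is then a relation in F lifting the given one. *)
Lemma pure_quot_flat (R : pzRingType) (F : lmodType R) (P : F -> Prop)
    (Psub : is_submod P) : flat F -> pure P -> flat (quot_mod Psub).
Proof.
move=> Ff Pp; apply/flat_iff => n r x.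
have [y yE] := choice (fun i => quot_pi_surj (x i)).
have xE : x =1 quot_pi Psub \o y by move=> i; rewrite /= yE.
rewrite (eq_lincomb r xE) -lincomb_linear -[0](linear0 (quot_pi Psub)).
move=> /quot_piP; rewrite subr0 => /Pp[w [Pw wE]].
have /flat_iff/(_ n r (fun i => y i - w i)) := Ff.
rewrite lincombDr lincombNr wE subrr => /(_ erefl) /(vanishing_linear (quot_pi Psub)).
apply: eq_vanishing => i /=; rewrite -yE; apply/quot_piP.
by rewrite addrAC subrr add0r; exact: submodN.
Qed.

(** * Nonzero pure submodules in the kernel of a map to N *)

Section SmallQuotient.
Variables (R : pzRingType) (N : lmodType R).

(* Names for the elements of the closure X of {x0}; see [idx_val]. *)
Inductive idx : Type :=
| IBase
| ILin of R & idx & idx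
| ISol n of 'rV[R]_n & idx & 'I_n
| IRoot n of 'rV[R]_n & idx.

(* A node asks for the selected entry of a tuple in F realizing prescribed linear
   relations and images in N, and agreeing with its children on a prescribed set
   of indices. *)
Inductive tree : Type :=
| Leaf
| Node of (idx -> Prop) & (R -> idx -> idx -> idx -> Prop) & (idx -> N)
    & idx & (idx -> tree).

Variables (F : lmodType R) (f : {linear F -> N}).

Definition realizes (D : idx -> Prop) (q : R -> idx -> idx -> idx -> Prop)
    (g : idx -> N) (z x : idx -> F) : Prop :=
  [/\ forall a, D a -> x a = z a,
      forall r a b c, q r a b c -> r *: x a + x b = x c &
      forall a, f (x a) = g a].

Definition some_or (T : Type) (x0 : T) (P : T -> Prop) : T :=
  if pselect (exists x, P x) is left h then sval (cid h) else x0.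

Lemma some_orP (T : Type) (x0 : T) (P : T -> Prop) :
  (exists x, P x) -> P (some_or x0 P).
Proof. by rewrite /some_or; case: pselect => // h _; exact: (svalP (cid h)). Qed.

Fixpoint tree_val (t : tree) : F :=
  match t with
  | Leaf => 0
  | Node D q g a ch =>
      some_or (fun=> 0) (realizes D q g (fun b => tree_val (ch b))) a
  end.

Definition reached (y : F) : Prop := exists t, tree_val t = y.

(** Nodes that differ only in the selected index evaluate to entries of one and the same chosen
    tuple, so that whole tuple is reached. *)
Lemma reached_realizes D q g z x : (forall a, reached (z a)) ->
  realizes D q g z x ->
  exists x', realizes D q g z x' /\ forall a, reached (x' a).
Proof.
move=> /choice[t tz] xz; have {}tz : (fun b => tree_val (t b)) = z by exact/funext.
exists (some_or (fun=> 0) (realizes D q g z)); split.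
  by apply: some_orP; exists x.
by move=> a; exists (Node D q g a t); rewrite /= tz.
Qed.

Variable x0 : F.

(** Names are formed whether or not the equation or congruence is solvable; an unsolvable one gets
    the default value 0. *)
Fixpoint idx_val (a : idx) : F :=
  match a with
  | IBase => x0
  | ILin r a b => r *: idx_val a + idx_val b
  | ISol n r a j => some_or (fun=> 0) (fun w => lincomb r w = idx_val a) j
  | IRoot n r a =>
      some_or 0 (fun y => reached y /\ exists w, lincomb r w = idx_val a - y)
  end.

Lemma idx_sol n (r : 'rV[R]_n) a w : lincomb r w = idx_val a ->
  exists b : 'I_n -> idx, lincomb r (idx_val \o b) = idx_val a.
Proof.
move=> wa; exists (fun j => ISol r a j).
by apply: (@some_orP _ (fun=> 0) (fun w => lincomb r w = idx_val a)); exists w.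
Qed.

Lemma idx_root n (r : 'rV[R]_n) a y w : reached y ->
  lincomb r w = idx_val a - y ->
  exists b w', reached (idx_val b) /\ lincomb r w' = idx_val a - idx_val b.
Proof.
move=> Yy wa; exists (IRoot r a).
set P := fun y => reached y /\ exists w, lincomb r w = idx_val a - y.
have : P (some_or 0 P) by apply: some_orP; exists y; split=> //; exists w.
by move=> [Yb [w' w'E]]; exists w'.
Qed.

Lemma unreached_pure : ~ reached x0 ->
  exists Q : F -> Prop,
    [/\ is_submod Q, pure Q, forall x, Q x -> f x = 0 & exists x, Q x /\ x <> 0].
Proof.
move=> x0Y; pose x := idx_val.
pose D a := reached (x a).
(* Off [D] the prescribed value is immaterial, and 0 is chosen because it is reached by [Leaf]. *)
pose z a := if `[< D a >] then x a else 0.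
have zY a : reached (z a).
  by rewrite /z; case: asboolP => // _; exists Leaf.
have xz : realizes D (fun r a b c => r *: x a + x b = x c) (f \o x) z x.
  by split=> // a Da; rewrite /z; case: asboolP.
have [x' [[x'D x'L x'f] x'Y]] := reached_realizes zY xz.
have {}x'D a : reached (x a) -> x' a = x a.
  by move=> Da; rewrite x'D // /z; case: asboolP.
(* A name for 0, used to turn equality of two values into a linear relation that [x'] must
   preserve. *)
pose o := ILin (-1) IBase IBase.
have xo : x o = 0 by rewrite /x /= scaleN1r addNr.
have x'lin r a b : x' (ILin r a b) = r *: x' a + x' b by apply/esym/x'L.
have x'o : x' o = 0 by rewrite x'lin scaleN1r addNr.
have x'ext a b : x a = x b -> x' a = x' b.
  move=> ab; have := x'L 1 a o b; rewrite scale1r xo addr0 => /(_ ab).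
  by rewrite scale1r x'o addr0.
have x'comb n (r : 'rV[R]_n) (b : 'I_n -> idx) d :
    lincomb r (x \o b) = x d -> lincomb r (x' \o b) = x' d.
  have [e [eE e'E]] : exists e, lincomb r (x \o b) = x e /\
      lincomb r (x' \o b) = x' e.
    rewrite /lincomb; elim: (index_enum _) => [|i s [e [eE e'E]]].
      by exists o; rewrite !big_nil xo x'o.
    exists (ILin (r 0 i) (b i) e).
    by rewrite !big_cons eE e'E x'lin.
  by rewrite eE e'E; exact: x'ext.
exists (fun u => exists a, u = x a - x' a); split.
- split; first by exists o; rewrite xo x'o subrr.
  move=> r u v [a ->] [b ->]; exists (ILin r a b).
  by rewrite x'lin {2}/x /= scalerBr opprD addrACA.
- move=> n r y [a aE].
  (* The value [x c] is reached, so it is its own copy. Hence [d], naming [x a - x c], satisfies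
     [x d - x' d = x a - x' a], and a solution for [x d] among named elements gives one in Q. *)
  have [c [w [cY wE]]] := idx_root (x'Y a) aE.
  pose d := ILin (-1) c a.
  have xd : x d = x a - x c by rewrite /x /= scaleN1r addrC.
  have x'd : x' d = x' a - x c by rewrite x'lin scaleN1r addrC (x'D c cY).
  have [b bE] := idx_sol (etrans wE (esym xd)).
  exists (fun i => x (b i) - x' (b i)); split; first by move=> i; exists (b i).
  rewrite lincombDr lincombNr [X in X - _]bE (x'comb _ _ _ _ bE).
  by rewrite aE -/x xd x'd opprB addrA subrK.
- by move=> u [a ->]; rewrite linearB x'f subrr.
- exists (x IBase - x' IBase); split; first by exists IBase.
  by move=> /subr0_eq xx'; apply: x0Y; rewrite -[x0]/(x IBase) xx'.
Qed.

End SmallQuotient.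

(** * Existence of flat precovers *)

Section Precover.
Variables (R : pzRingType) (N : lmodType R).

Lemma small_flat_factor (F : lmodType R) (f : {linear F -> N}) : flat F ->
  exists (G : lmodType R) (p : {linear F -> G}) (g : {linear G -> N})
    (e : tree N -> G),
    [/\ flat G, g \o p =1 f & forall y, exists t, e t = y].
Proof.
move=> Ff.
(* Closure under [r *: x + y] without 0 lets the empty set be good, as the union of an empty chain
   must be; maximality then gives [P 0], since the zero submodule is good. *)
pose good (P : F -> Prop) :=
  [/\ forall r x y, P x -> P y -> P (r *: x + y), pure P & forall x, P x -> f x = 0].
have [P [[PL Pp Pf] Pmax]] : exists P, good P /\ forall Q, (P `<` Q)%classic -> ~ good Q.
  apply: (@Zorn_bigcup _ good) => C Cgood Ctot; split.
  - move=> r x y [A CA Ax] [B CB By].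
    have [AB|BA] := Ctot _ _ CA CB.
      by exists B => //; have [BL _ _] := Cgood _ CB; apply: BL => //; exact: AB.
    by exists A => //; have [AL _ _] := Cgood _ CA; apply: AL => //; exact: BA.
  - move=> n r y [A CA Ary]; have [_ Ap _] := Cgood _ CA.
    have [w [Aw wE]] := Ap _ _ _ Ary.
    by exists w; split=> // i; exists A.
  - by move=> x [A CA Ax]; have [_ _ ->] := Cgood _ CA.
have P0 : P 0.
  have [[x Px]|noP] := pselect (exists x, P x).
    by have := PL (-1) x x Px Px; rewrite scaleN1r addNr.
  exfalso; apply: (Pmax (fun x => x = 0)).
    split; first by move=> x Px; case: noP; exists x.
    by move=> /(_ 0 erefl) P0; apply: noP; exists 0.
  split.
  - by move=> r x y -> ->; rewrite scaler0 addr0.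
  - move=> n r y ry; exists (fun=> 0); split=> //; rewrite ry /lincomb big1 //.
    by move=> i _; rewrite scaler0.
  - by move=> x ->; rewrite linear0.
have Psub : is_submod P by [].
have [g gE] := quot_lift Psub Pf.
exists (quot_mod Psub), (quot_pi Psub), g, (tree_val g); split=> //.
  exact: pure_quot_flat.
move=> x0; apply: contrapT => x0Y.
have [Q [[Q0 QL] Qp Qg [x1 [Qx1 x1n0]]]] := unreached_pure x0Y.
(* The preimage of a nonzero [Q] is strictly larger than [P], so it remains to see that it is
   good. *)
apply: (Pmax (Q \o quot_pi Psub)).
  split=> [x Px /=|PQ].
    have -> : quot_pi Psub x = quot_pi Psub 0 by apply/quot_piP; rewrite subr0.
    by rewrite linear0.
  have [v vE] := quot_pi_surj x1; apply: x1n0.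
  rewrite -vE -[RHS](linear0 (quot_pi Psub)); apply/quot_piP; rewrite subr0.
  by apply: PQ; rewrite /= vE.
split.
- by move=> r x y Qx Qy; rewrite /= linearP; exact: QL.
- move=> n r y; rewrite /= lincomb_linear => /Qp[w [Qw wE]].
  have [v vE] := choice (fun i => quot_pi_surj (w i)).
  have vw : quot_pi Psub \o v =1 w by [].
  (* The combinations of [y] and of the lift [v] differ by an element of [P]; purity of [P] writes
     it as a combination of some [u] in [P], and [v + u] is the required family. *)
  move: wE; rewrite -(eq_lincomb r vw) -!lincomb_linear => /esym/quot_piP.
  rewrite -lincombNr -lincombDr => /Pp[u [Pu]].
  rewrite lincombDr lincombNr => uE.
  exists (fun i => v i + u i); split; last by rewrite lincombDr uE addrC subrK.
  move=> i; rewrite /= linearD /= vE; suff -> : quot_pi Psub (u i) = 0 by rewrite addr0.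
  by rewrite -[RHS](linear0 (quot_pi Psub)); apply/quot_piP; rewrite subr0.
- by move=> x Qx; rewrite -gE; exact: Qg.
Qed.

(* Pulling the module structure back along a surjection from [tree N] gives a
   small index type for the isomorphism classes of the quotients above. *)
Let code : Type :=
  ((R -> tree N -> tree N -> tree N -> Prop) * (tree N -> N))%type.

Let codes (c : code) (G : lmodType R) (g : {linear G -> N}) : Prop :=
  flat G /\ exists e : tree N -> G,
    [/\ forall y, exists t, e t = y,
        forall r s t u, c.1 r s t u <-> r *: e s + e t = e u &
        forall t, g (e t) = c.2 t].

(** A section of [e] followed by [e'] is linear, because both surjections obey exactly the relations
    recorded in [c.1]. *)
Lemma coded_hom c (G G' : lmodType R) (g : {linear G -> N}) (g' : {linear G' -> N}) :
  codes c g -> codes c g' -> exists h : {linear G -> G'}, g' \o h =1 g.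
Proof.
move=> [_ [e [esurj eL eN]]] [_ [e' [e'surj e'L e'N]]].
have [k kE] := choice esurj.
have [h hE] : exists h : {linear G -> G'}, h =1 e' \o k.
  by apply: linear_bundle => r x y /=; apply/esym/e'L/eL; rewrite !kE.
by exists h => y /=; rewrite hE /= e'N -eN kE.
Qed.

Lemma flat_precover_exists :
  exists (F : lmodType R) (g : {linear F -> N}), flat_precover g.
Proof.
have ex c : exists G : {G : lmodType R & {linear G -> N}},
    flat (projT1 G) /\ ((exists (G' : lmodType R) (g' : {linear G' -> N}), codes c g') ->
      codes c (projT2 G)).
  have [[G [g cg]]|nc] := pselect (exists (G : lmodType R) (g : {linear G -> N}), codes c g).
    by exists (existT _ G g); split=> //; have [] := cg.
  (* Codes of no module get the zero map from R, so that every summand is flat. *)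
  have [z _] : exists z : {linear R^o -> N}, z =1 fun=> 0.
    by apply: linear_bundle => r x y; rewrite scaler0 addr0.
  by exists (existT _ (R^o : lmodType R) z); split=> // ; exact: regular_flat.
have [G GP] := choice ex.
have [h hE] := dsum_lift (fun c => projT2 (G c)).
exists (submodule (finsupp_submod (fun c => projT1 (G c)))), h; split.
  by apply: dsum_flat => c; have [] := GP c.
move=> F' F'flat u.
have [K [p [g [e [Kflat gp esurj]]]]] := small_flat_factor u F'flat.
pose c : code := (fun r s t w => r *: e s + e t = e w, g \o e).
have cg : codes c g by split=> //; exists e; split.
have [_ /(_ (ex_intro _ K (ex_intro _ g cg))) cG] := GP c.
have [k kE] := coded_hom cg cG.
have [q qE] := @dsum_inj _ _ (fun c => projT1 (G c)) c.
exists (q \o k \o p) => x; rewrite -gp /= -kE.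
exact: (hE c q qE (k (p x))).
Qed.
End Precover.

(** * Comparison of the two domains *)

Lemma flat_precover_surj (R : pzRingType) (F N : lmodType R) (g : {linear F -> N}) :
  flat_precover g -> forall y, exists x, g x = y.
Proof.
move=> [_ gp] y.
have [u uE] : exists u : {linear R^o -> N}, u =1 fun r => (r : R) *: y.
  by apply: linear_bundle => r a b; rewrite scalerDl scalerA.
have [v vE] := gp _ (@regular_flat R) u.
by exists (v 1); rewrite -[LHS]/((g \o v) 1) vE uE scale1r.
Qed.

(** The pullback of [g] and [p] projects onto F because [g] is onto; lift [h] to it and project to
    B. *)
Lemma subprojectivity_domain_factor (R : pzRingType) (M F N : lmodType R)
    (h : {linear M -> F}) (p : {linear F -> N}) (B : lmodType R) (g : {linear B -> N}) :
  subprojectivity_domain M F -> (forall y, exists x, g x = y) ->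
  exists k : {linear M -> B}, g \o k =1 p \o h.
Proof.
move=> MF gsurj.
have Psub : is_submod (fun u : B * F => g u.1 = p u.2).
  split=> [|r x y /= xE yE]; first by rewrite /= !linear0.
  by rewrite !linearP xE yE.
have [pB pBE] : exists q : {linear submodule Psub -> B}, q =1 fun u => (submod_val u).1.
  exact: linear_bundle.
have [pF pFE] : exists q : {linear submodule Psub -> F}, q =1 fun u => (submod_val u).2.
  exact: linear_bundle.
have [|k kE] := MF _ pF h.
  move=> y; have [x xE] := gsurj (p y).
  by exists (@submod_of _ _ _ Psub (x, y) xE); rewrite pFE.
exists (pB \o k) => m /=; rewrite pBE (submod_prop (k m)) -pFE.
by rewrite -[pF (k m)]/((pF \o k) m) kE.
Qed.

Theorem proposition3p4 (R : pzRingType) (M : lmodType R) :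
  (forall N : lmodType R,
     flat_precover_completing_domain M N <-> subprojectivity_domain M N) <->
  (forall F : lmodType R, flat F -> subprojectivity_domain M F).
Proof.
split=> [dom F Fflat|flatM N].
  apply/dom => f G g [Gflat gp].
  (* A precover of a flat module splits, since the identity factors through it. *)
  have [v vE] := gp F Fflat idfun.
  by exists (v \o f) => m; exact: (vE (f m)).
split=> [MN B g f gsurj|MN f F g gp]; last first.
  by apply: MN; exact: flat_precover_surj.
have [F [p pp]] := flat_precover_exists N.
have [h hE] := MN f F p pp.
have [Fflat _] := pp.
have [k kE] := subprojectivity_domain_factor h p (flatM F Fflat) gsurj.
by exists k => m; rewrite kE hE.
Qed.
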